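(* Let $(X,\Sigma,\mu)$ be a $\sigma$-finite complete non-atomic measure space and let $\Phi_1,\Phi_2$ be Young functions such that $\Phi_2\not\prec\Phi_1$. Then there is no non-zero bounded operator of the form $M_{u,T}=M_uC_T$, $M_{u,T}f=u\cdot(f\circ T)$ (with $u\in L^0(\Sigma)$ and $T:X\to X$ a nonsingular measurable transformation), from $L^{\Phi_1}(\Sigma)$ to $L^{\Phi_2}(\Sigma)$.
   Context: A Young function is a continuous convex function $\Phi:\mathbb{R}\to\mathbb{R}$ such that $\Phi(x)=0$ if and only if $x=0$, $\Phi(-x)=\Phi(x)$, $\lim_{x\to\infty}\Phi(x)/x=\infty$ and $\lim_{x\to\infty}\Phi(x)=\infty$. $\Phi_2\prec\Phi_1$ means there are $a\ge0$ and $x_0\ge0$ with $\Phi_2(x)\le\Phi_1(ax)$ for all $x\ge x_0$; $\Phi_2\not\prec\Phi_1$ is its negation. $L^0(\Sigma)$ is the space of $\mu$-a.e. equivalence classes of scalar-valued $\Sigma$-measurable functions on $X$; $\Phi(f)$ means $\Phi(|f|)$. $L^{\Phi}(\Sigma)=\{f\in L^0(\Sigma): \exists k>0,\ \int_X\Phi(kf)\,d\mu<\infty\}$ with norm $\|f\|_\Phi=\inf\{k>0:\int_X\Phi(f/k)\,d\mu\le1\}$. An atom is a set $A\in\Sigma$ with $\mu(A)>0$ such that every measurable $F\subseteq A$ has $\mu(F)=0$ or $\mu(F)=\mu(A)$; the measure space is non-atomic if it has no atoms. A measurable $T:X\to X$ is nonsingular if $\mu(A)=0$ implies $\mu(T^{-1}(A))=0$.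 *)

(* Defs.v *)
From HB Require Import structures.
From mathcomp Require Import all_boot all_order all_algebra.
From mathcomp Require Import complex.
From mathcomp Require Import all_classical all_reals all_analysis.

Set Implicit Arguments.
Unset Strict Implicit.
Unset Printing Implicit Defensive.

Import Order.TTheory GRing.Theory Num.Theory.
Import numFieldNormedType.Exports.

Local Open Scope classical_set_scope.
Local Open Scope ring_scope.

Record young_function (R : realType) (Phi : R -> R) : Prop := YoungFunction {
  young_continuous : continuous Phi ;
  young_convex :
    convex_function [set: convex_lmodType R^o] (Phi : R^o -> R^o) ;
  young_eq0 : forall x, Phi x = 0 <-> x = 0 ;
  young_even : forall x, Phi (- x) = Phi x ;
  young_superlinear : (Phi x / x) @[x --> +oo] --> +oo ;
  young_cvg_pinfty : Phi x @[x --> +oo] --> +oo }.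

Definition young_le (R : realType) (Phi2 Phi1 : R -> R) : Prop :=
  exists a x0 : R, [/\ 0 <= a, 0 <= x0 &
    forall x, x0 <= x -> Phi2 x <= Phi1 (a * x)].

(* Scalar-valued functions are real-valued or complex-valued; both cases are
   covered by a parameter of type scalar_kind. *)
Inductive scalar_kind := RealScalars | ComplexScalars.

Definition scalar_field (R : realType) (k : scalar_kind) : numFieldType :=
  match k with RealScalars => R | ComplexScalars => complex R end.

(* The MathComp norm of a complex number is a complex number; the modulus is
   the same quantity as a real number. *)
Definition modulus (R : realType) (k : scalar_kind) : scalar_field R k -> R :=
  match k with
  | RealScalars => fun x : R => `|x|
  | ComplexScalars => fun z : complex R => complex.Re `|z|
  end.

Notation borel_scalar R k := (g_sigma_algebraType (@open (scalar_field R k))).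

Section measure_space.
Context d (X : measurableType d) (R : realType).
Variable mu : {measure set X -> \bar R}.

Definition atom (A : set X) : Prop :=
  [/\ measurable A, (0 < mu A)%E &
    forall F, measurable F -> F `<=` A -> mu F = 0%E \/ mu F = mu A].

Definition nonatomic : Prop := forall A, ~ atom A.

Definition nonsingular (T : X -> X) : Prop :=
  forall A, measurable A -> mu A = 0%E -> mu (T @^-1` A) = 0%E.

Variable k : scalar_kind.

Definition L0 : Type := {mfun_ mu, X >-> borel_scalar R k}.

(* A class in L0 coerces to its canonical representative. *)
Definition L0_fun (f : L0) : X -> scalar_field R k :=
  (f : {mfun_ mu, X >-> borel_scalar R k}).
Coercion L0_fun : L0 >-> Funclass.

Variable Phi : R -> R.

Definition orlicz_space : set L0 :=
  [set f : L0 | exists2 c : R, 0 < c &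
    (\int[mu]_x (Phi (c * modulus (f x)))%:E < +oo)%E].

(* The infimum is taken in R, where inf of the empty set is 0; for f in
   orlicz_space with Phi a Young function the set is nonempty. *)
Definition luxemburg_norm (f : L0) : R :=
  inf [set c : R | 0 < c /\
    (\int[mu]_x (Phi (modulus (f x) / c))%:E <= 1)%E].

End measure_space.
Arguments L0 {d X R} mu k.
Arguments orlicz_space {d X R} mu k Phi.
Arguments luxemburg_norm {d X R mu k} Phi f.

Section operators.
Context d (X : measurableType d) (R : realType).
Variables (mu : {measure set X -> \bar R}) (k : scalar_kind).
Variables (Phi1 Phi2 : R -> R).
Variable M : orlicz_space mu k Phi1 -> orlicz_space mu k Phi2.

(* M f = u * (f \o T) in L0, for every f; this equation makes M linear. When T
   is nonsingular it does not depend on the representatives of u and f. *)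
Definition weighted_composition (u : L0 mu k) (T : X -> X) : Prop :=
  forall f : orlicz_space mu k Phi1,
    {ae mu, forall x, val (M f) x = u x * val f (T x)}.

Definition bounded_operator : Prop :=
  exists C : R, forall f : orlicz_space mu k Phi1,
    luxemburg_norm Phi2 (val (M f)) <= C * luxemburg_norm Phi1 (val f).

Definition nonzero_operator : Prop :=
  exists f : orlicz_space mu k Phi1,
    ~ {ae mu, forall x, val (M f) x = 0}.

End operators.

(* Main.v *)
(* Suppose u . (f o T) defines a nonzero bounded operator of norm at most D.
   Then |u| >= r on some E with 0 < mu(E) < oo, and the finite measure
   nu(A) = mu(T^-1(A) :&: E) is absolutely continuous with respect to mu, so by
   Radon-Nikodym nu >= e mu on the subsets of some B with 0 < mu(B) < oo. For y
   large, non-atomicity gives A in B with mu(A) between 1/(2 Phi1(y)) and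
   1/Phi1(y). The function y 1_A has Phi1-norm at most 1, hence its image, whose
   modulus is at least r y on T^-1(A) :&: E, satisfies
   Phi2(r y / (2 D)) nu(A) <= 1, that is Phi2(r y / (2 D)) <= (2 / e) Phi1(y).
   By convexity the constant 2 / e can be absorbed in the argument of Phi1,
   which yields the excluded comparison of Phi2 with Phi1. *)
Require Import Defs.
From HB Require Import structures.
From mathcomp Require Import all_boot all_order all_algebra.
From mathcomp Require Import complex.
From mathcomp Require Import all_classical all_reals all_analysis.
From mathcomp Require Import measurable_realfun ring lra.

Set Implicit Arguments.
Unset Strict Implicit.
Unset Printing Implicit Defensive.

Import Order.TTheory GRing.Theory Num.Theory.
Import numFieldNormedType.Exports.

Local Open Scope classical_set_scope.
Local Open Scope ring_scope.

(** * Elementary inequalities for Young functions *)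

Section young.
Context (R : realType) (Phi : R -> R) (young : young_function Phi).

Lemma young0 : Phi 0 = 0.
Proof. by have [_ ->] := young_eq0 young 0. Qed.

Lemma young_conv t x y : 0 <= t <= 1 ->
  Phi (t * x + (1 - t) * y) <= t * Phi x + (1 - t) * Phi y.
Proof.
move=> /andP[t0 t1].
have := young_convex young (Itv01 t0 t1) (in_setT x) (in_setT y).
by rewrite !convRE.
Qed.

Lemma young_scale t x : 0 <= t <= 1 -> Phi (t * x) <= t * Phi x.
Proof.
by move=> t01; have := young_conv x 0 t01; rewrite young0 !mulr0 !addr0.
Qed.

(** Since 0 is the midpoint of [x] and [- x], convexity and evenness bound [Phi 0 = 0] by
    [Phi x]. *)
Lemma young_ge0 x : 0 <= Phi x.
Proof.
have := @young_conv 2^-1 x (- x); rewrite (young_even young).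
have -> : 2^-1 * x + (1 - 2^-1) * - x = 0 by lra.
rewrite young0 => /(_ _)H; suff: 0 <= 2^-1 * Phi x + (1 - 2^-1) * Phi x by lra.
by apply: H; lra.
Qed.

Lemma young_gt0 x : 0 < x -> 0 < Phi x.
Proof.
move=> x0; rewrite lt_neqAle young_ge0 andbT eq_sym; apply/eqP.
by move=> /(young_eq0 young) x00; rewrite x00 ltxx in x0.
Qed.

Lemma young_homo x y : 0 <= x -> x <= y -> Phi x <= Phi y.
Proof.
move=> x0 xy; have [y0|y0] := leP y 0.
  by have -> : x = y by lra.
have t01 : 0 <= x / y <= 1.
  by rewrite divr_ge0 ?(ltW y0)//= ler_pdivrMr// mul1r.
have := young_scale y t01; rewrite divfK ?gt_eqF// => /le_trans; apply.
by rewrite ler_piMl ?young_ge0//; case/andP: t01.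
Qed.

(** Apply [young_scale] with factor [t^-1] at the point [t * x]. This is how a constant in front of
    a Young function is absorbed in its argument. *)
Lemma young_scale_ge1 t x : 1 <= t -> t * Phi x <= Phi (t * x).
Proof.
move=> t1; have t0 : 0 < t by lra.
have := @young_scale t^-1 (t * x); rewrite mulKf ?gt_eqF//.
rewrite ler_pdivlMl//; apply.
by rewrite invr_ge0 ltW//= invf_le1.
Qed.

End young.

(** * Real and complex scalars and their modulus *)

Section scalars.
Context (R : realType) (k : scalar_kind).
Implicit Types (r : R) (z w : scalar_field R k).

(** The order embedding of the reals into the scalars. Norms take values in the scalar field, so
    relations between moduli are proved by pulling relations between norms back along this map. *)
Definition real_scalar r : scalar_field R k :=
  match k with RealScalars => r | ComplexScalars => r%:C%C end.

Lemma normE z : `|z| = real_scalar (modulus z).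
Proof.
rewrite /real_scalar /modulus; by case: k z.
Qed.

Lemma real_scalar_le r s : (real_scalar r <= real_scalar s) = (r <= s).
Proof. by rewrite /real_scalar; case: k => //; rewrite lecR. Qed.

Lemma real_scalar_lt r s : (real_scalar r < real_scalar s) = (r < s).
Proof. by rewrite /real_scalar; case: k => //; rewrite ltcR. Qed.

Lemma real_scalar0 : real_scalar 0 = 0.
Proof. by rewrite /real_scalar; case: k. Qed.

Lemma real_scalarM r s : real_scalar (r * s) = real_scalar r * real_scalar s.
Proof. by rewrite /real_scalar; case: k => //; rewrite rmorphM. Qed.

Lemma real_scalarD r s : real_scalar (r + s) = real_scalar r + real_scalar s.
Proof. by rewrite /real_scalar; case: k => //; rewrite rmorphD. Qed.

Lemma real_scalar_inj : injective real_scalar.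
Proof.
by move=> r s rs; apply/le_anti; rewrite -!real_scalar_le rs lexx.
Qed.

Lemma modulus_ge0 z : 0 <= modulus z.
Proof. by rewrite -real_scalar_le real_scalar0 -normE. Qed.

Lemma modulus_eq0 z : modulus z = 0 -> z = 0.
Proof.
by move=> z0; apply/eqP; rewrite -normr_eq0 normE z0 real_scalar0.
Qed.

Lemma modulus0 : modulus (0 : scalar_field R k) = 0.
Proof. by apply: real_scalar_inj; rewrite -normE normr0 real_scalar0. Qed.

Lemma modulusM z w : modulus (z * w) = modulus z * modulus w.
Proof.
by apply: real_scalar_inj; rewrite real_scalarM -!normE normrM.
Qed.

Lemma modulus_real_scalar r : 0 <= r -> @modulus R k (real_scalar r) = r.
Proof.
move=> r0; apply: real_scalar_inj; rewrite -normE ger0_norm//.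
by rewrite -real_scalar0 real_scalar_le.
Qed.

(** By the triangle inequality, the ball of radius [modulus z - r] around [z] stays in the set.
    These sets are the preimages of the rays that generate the Borel sets of the line, whence the
    measurability of the modulus. *)
Lemma open_modulus_gt r : open [set z : scalar_field R k | r < modulus z].
Proof.
rewrite openE => z /= rz; apply/nbhs_ballP.
exists (real_scalar (modulus z - r)).
  by rewrite /= -real_scalar0 real_scalar_lt subr_gt0.
move=> w; rewrite -ball_normE /=; rewrite normE real_scalar_lt => zw.
have : modulus z <= modulus (z - w) + modulus w.
  by rewrite -real_scalar_le real_scalarD -!normE -lerBlDr lerB_dist.
lra.
Qed.

Lemma measurable_modulus :
  measurable_fun [set: borel_scalar R k] (@modulus R k : borel_scalar R k -> R).
Proof.
apply: (measurability _ (RGenOInfty.measurableE R)).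
move=> _ [_ [r ->] <-]; rewrite setTI.
apply: sub_sigma_algebra; rewrite preimage_itvoy.
exact: open_modulus_gt.
Qed.

End scalars.

(** * Sets of prescribed size in sigma-finite and non-atomic measures *)

Section measure_lemmas.
Context d (X : measurableType d) (R : realType).
Variable mu : {measure set X -> \bar R}.
Local Open Scope ereal_scope.

Lemma measure_bigcup_neq0 (F : (set X)^nat) : (forall n, measurable (F n)) ->
  mu (\bigcup_n F n) != 0 -> exists n, 0 < mu (F n).
Proof.
move=> mF /eqP F_neq0; apply: contrapT => /forallNP F0; apply: F_neq0.
apply/negligibleP; first exact: bigcup_measurable.
apply: negligible_bigcup => n; apply/negligibleP => //.
by apply/eqP; rewrite eq_le measure_ge0 andbT leNgt; apply/negP/F0.
Qed.

(** Countably many sets of finite measure cover [A], so one of them meets [A] in positive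
    measure. *)
Lemma sigma_finite_subset (A : set X) : sigma_finite [set: X] mu ->
  measurable A -> mu A != 0 ->
  exists B, [/\ measurable B, B `<=` A, 0 < mu B & mu B < +oo].
Proof.
move=> [F UF mF] mA A0.
have mAF n : measurable (A `&` F n) by apply: measurableI => //; exact: (mF n).1.
have [|n An] := @measure_bigcup_neq0 (fun n => A `&` F n) mAF.
  by rewrite -setI_bigcupr -UF setIT.
exists (A `&` F n); split; [exact: mAF|exact: subIsetl|exact: An|].
apply: le_lt_trans (mF n).2; apply: le_measure; rewrite ?inE//.
exact: (mF n).1.
Qed.

Hypothesis mu_nonatomic : nonatomic mu.

(** As [B] is not an atom, it splits into [F] and its complement in [B], both of positive measure;
    the smaller piece has at most half the measure. *)
Lemma nonatomic_half (B : set X) : measurable B -> 0 < mu B -> mu B < +oo ->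
  exists A, [/\ measurable A, A `<=` B, 0 < mu A & mu A <= (2^-1)%:E * mu B].
Proof.
move=> mB B0 Boo; apply: contrapT => noA; apply: (@mu_nonatomic B).
split => // F mF FB; apply: contrapT => /not_orP[/eqP F0 /eqP FnB].
have mBF : measurable (B `\` F) by exact: measurableD.
have Fp : 0 < mu F by rewrite lt0e F0 measure_ge0.
have muB : mu B = mu (B `\` F) + mu F.
  by rewrite (measureDI mu mB mF) (setIidr FB).
have Foo : mu F < +oo by apply: le_lt_trans Boo; apply: le_measure; rewrite ?inE.
have Doo : mu (B `\` F) < +oo.
  by apply: le_lt_trans Boo; apply: le_measure; rewrite ?inE//; exact: subDsetl.
have fF : mu F \is a fin_num by rewrite ge0_fin_numE.
have fD : mu (B `\` F) \is a fin_num by rewrite ge0_fin_numE.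
have Dp : 0 < mu (B `\` F).
  rewrite lt0e measure_ge0 andbT; apply: contra FnB => /eqP D0.
  by rewrite muB D0 add0e.
move: muB (Dp) (Fp).
rewrite -(fineK fF) -(fineK fD) !lte_fin -EFinD => muB fD0 fF0.
have [FD|DF] := leP (fine (mu F)) (fine (mu (B `\` F))).
- apply: noA; exists F; split => //.
  by rewrite muB -(fineK fF) -EFinM lee_fin; lra.
- apply: noA; exists (B `\` F); split => //.
  by rewrite muB -(fineK fD) -EFinM lee_fin; lra.
Qed.

Lemma nonatomic_small (B : set X) (e : R) : measurable B ->
  0 < mu B -> mu B < +oo -> (0 < e)%R ->
  exists A, [/\ measurable A, A `<=` B, 0 < mu A & mu A < e%:E].
Proof.
move=> mB B0 Boo e0.
(* Iterated halving; the factor [2^-1 ^+ n] eventually drops below [e / mu B]. *)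
have geo n : exists A,
    [/\ measurable A, A `<=` B, 0 < mu A & mu A <= (2^-1 ^+ n)%:E * mu B].
  elim: n => [|n [A [mA AB A0 An]]]; first by exists B; rewrite expr0 mul1e lexx; split.
  have [|C [mC CA C0 Cn]] := nonatomic_half mA A0.
    by apply: le_lt_trans Boo; apply: le_measure; rewrite ?inE.
  exists C; split => //; first exact: subset_trans AB.
  rewrite (le_trans Cn)// exprS EFinM -muleA.
  by apply: lee_pmul => //; rewrite lee_fin invr_ge0.
have fB : mu B \is a fin_num by rewrite ge0_fin_numE.
have fB0 : (0 < fine (mu B))%R by rewrite -lte_fin fineK.
have : (2^-1 ^+ n)%R @[n --> \oo] --> (0 : R)%R.
  by apply: cvg_expr; rewrite ger0_norm ?invr_ge0// invf_lt1// ltr1n.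
move=> /cvgr0Pnorm_lt/(_ (e / fine (mu B))%R); rewrite divr_gt0// => /(_ isT).
move=> [n _ /(_ n (leqnn n))/=]; rewrite ger0_norm ?exprn_ge0 ?invr_ge0//.
rewrite ltr_pdivlMr// => ne.
have [A [mA AB A0 An]] := geo n; exists A; split => //.
by rewrite (le_lt_trans An)// -(fineK fB) -EFinM lte_fin.
Qed.

(* A weak form of Sierpinski's theorem: sets of measure below [m / 2] would
   otherwise be stable under union, hence one of them would be of maximal
   measure, while any of them can be enlarged by a set of small measure. *)
Lemma nonatomic_intermediate (B : set X) (m : R) : measurable B ->
  mu B < +oo -> (0 < m)%R -> m%:E <= mu B ->
  exists A, [/\ measurable A, A `<=` B, (m / 2)%:E <= mu A & mu A <= m%:E].
Proof.
move=> mB Boo m0 mleB; apply: contrapT => noA.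
pose small A := [/\ measurable A, A `<=` B & mu A < (m / 2)%:E].
(* No subset of [B] has measure in the interval from [m / 2] to [m], so the bound [m] improves by
   itself to a strict bound [m / 2]. This is what keeps small sets stable under union. *)
have smallP A : measurable A -> A `<=` B -> mu A <= m%:E -> small A.
  move=> mA AB Am; split => //; rewrite ltNge; apply/negP => mA2.
  by apply: noA; exists A.
have fin_small A : small A -> mu A \is a fin_num.
  by move=> [_ _ Am]; rewrite ge0_fin_numE// (lt_trans Am)// ltry.
have smallU A C : small A -> small C -> small (A `|` C).
  move=> [mA AB Am] [mC CB Cm]; apply: smallP.
  - exact: measurableU.
  - by rewrite subUset.
  - rewrite (le_trans (measureU2 _ mA mC))// (splitr m) EFinD.
    by apply: leeD; exact: ltW.
pose S := [set fine (mu A) | A in small].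
have ubS : ubound S (m / 2)%R.
  move=> _ [A sA <-]; rewrite -lee_fin fineK ?fin_small//.
  by case: sA => _ _ /ltW.
have hsS : has_sup S.
  split; last by exists (m / 2)%R.
  exists (fine (mu set0)), set0 => //; apply: smallP => //.
  by rewrite measure0 lee_fin ltW.
have /choice[A_ A_P] n : exists A, small A /\ (sup S - n.+1%:R^-1 < fine (mu A))%R.
  have [|_ [A sA <-] An] := @sup_adherent _ S n.+1%:R^-1 _ hsS.
    by rewrite invr_gt0.
  by exists A.
pose U n := \big[setU/set0]_(i < n.+1) A_ i.
have sU n : small (U n).
  rewrite /U; elim: n => [|n IHn]; first by rewrite big_ord1; case: (A_P 0%N).
  by rewrite big_ord_recr/=; apply: smallU => //; case: (A_P n.+1).
pose V := \bigcup_n U n.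
have mV : measurable V by apply: bigcup_measurable => n _; case: (sU n).
have VB : V `<=` B by apply: bigcup_sub => n _; case: (sU n).
(* The strict bound is lost in the limit along the increasing sets [U n], but a measure of at most
   [m] suffices, by [smallP], to make [V] small again. *)
have Vm : mu V <= m%:E.
  have ndU : {homo U : n p / (n <= p)%N >-> (n <= p)%O}.
    by move=> n p np; apply/subsetPset; exact: subset_bigsetU.
  have mUn n : measurable (U n) by case: (sU n).
  have cV := @nondecreasing_cvg_mu _ _ _ mu U mUn mV ndU.
  rewrite -(cvg_lim _ cV)//; apply: lime_le; first by apply/cvg_ex; exists (mu V).
  apply: nearW => n /=; have [_ _ /ltW Um] := sU n.
  by rewrite (le_trans Um)// lee_fin; lra.
have sV : small V by exact: smallP.
have supV : (sup S <= fine (mu V))%R.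
  rewrite leNgt; apply/negP => /ltr_add_invr[n Vn].
  have [[mA _ _] An] := A_P n; suff : (fine (mu (A_ n)) <= fine (mu V))%R.
    by move=> AV; move: An Vn; set r := (n.+1%:R^-1 : R)%R; lra.
  apply: fine_le; first by apply: fin_small; case: (A_P n).
    exact: fin_small.
  apply: le_measure; rewrite ?inE//; apply: subset_trans (bigcup_sup _) => //.
  by rewrite /U big_ord_recr; exact: subsetUr.
have mBV : measurable (B `\` V) by exact: measurableD.
have BV0 : 0 < mu (B `\` V).
  have VltB : mu V < mu B.
    by case: sV => _ _ /lt_trans; apply; rewrite (lt_le_trans _ mleB)// lte_fin; lra.
  rewrite lt0e measure_ge0 andbT; apply: contraTN VltB => /eqP BV0.
  have muB : mu B = mu (B `\` V) + mu V.
    by rewrite (measureDI mu mB mV) (setIidr VB).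
  by rewrite muB BV0 add0e ltxx.
have BVoo : mu (B `\` V) < +oo.
  by apply: le_lt_trans Boo; apply: le_measure; rewrite ?inE//; exact: subDsetl.
have m20 : (0 < m / 2)%R by lra.
have [F [mF FBV F0 Fm]] := nonatomic_small mBV BV0 BVoo m20.
have sF : small F by split => //; apply: subset_trans FBV _; exact: subDsetl.
have VF : mu (V `|` F) = mu V + mu F.
  rewrite measureU//; apply/seteqP; split => // x [Vx /FBV[]].
  by [].
have sVF := smallU _ _ sV sF.
have : (fine (mu (V `|` F)) <= sup S)%R.
  by apply: ub_le_sup; [exists (m / 2)%R|exists (V `|` F)].
rewrite VF fineD ?fin_small//.
have : (0 < fine (mu F))%R by rewrite -lte_fin fineK ?fin_small.
lra.
Qed.

End measure_lemmas.

(** * A lower bound from the Radon-Nikodym density *)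

Section density.
Context d (X : measurableType d) (R : realType).
Variables (mu nu : {measure set X -> \bar R}).
Local Open Scope ereal_scope.

(** The density [f] of [nu] is not almost everywhere zero, so it is at least some [n.+1%:R^-1] on a
    set of positive measure; integrate this bound over subsets. *)
Lemma dominates_lower_bound : sigma_finite [set: X] mu ->
  fin_num_fun nu -> nu `<< mu -> nu [set: X] != 0 ->
  exists (e : R) (B : set X), [/\ (0 < e)%R, measurable B,
    0 < mu B & mu B < +oo] /\
    forall A, measurable A -> A `<=` B -> e%:E * mu A <= nu A.
Proof.
move=> muF nuF dom nuT.
(* The hypotheses on [mu] and [nu] are repackaged as the sigma-finite and finite measure structures
   that the Radon-Nikodym theorem expects. *)
pose mu_sigma_finite := isSigmaFinite.Build _ _ _ (Measure.sort mu) muF.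
pose mu_sfinite := isSFinite.Build _ _ _ (Measure.sort mu)
  (sfinite_measure_sigma_finite muF).
pose mu' := HB.pack_for {sigma_finite_measure set X -> \bar R}
  (Measure.sort mu) mu_sigma_finite mu_sfinite.
have nuSF : sigma_finite [set: X] nu.
  by apply: fin_num_fun_sigma_finite; rewrite ?measure0.
pose nu_sigma_finite := isSigmaFinite.Build _ _ _ (Measure.sort nu) nuSF.
pose nu_sfinite := isSFinite.Build _ _ _ (Measure.sort nu)
  (sfinite_measure_sigma_finite nuSF).
pose nu_finite := isFinite.Build _ _ _ (Measure.sort nu) nuF.
pose nu' := HB.pack_for {finite_measure set X -> \bar R}
  (Measure.sort nu) nu_sigma_finite nu_sfinite nu_finite.
have [f [f0 ffin fint nuE]] := @radon_nikodym_sigma_finite _ _ _ mu' nu' dom.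
have {}nuE A : measurable A -> nu A = \int[mu]_(x in A) f x by exact: nuE.
have mf : measurable_fun [set: X] f by exact: measurable_int fint.
pose D n := [set x | (n.+1%:R^-1)%:E <= f x].
have mD n : measurable (D n).
  by rewrite -[D n]setTI; exact: emeasurable_fun_c_infty.
have [|n Dn] := @measure_bigcup_neq0 _ _ _ mu D mD.
  (* If the union of the [D n] were null, [f] would vanish almost everywhere and [nu] would be
     zero. *)
  apply: contra_neq nuT => D0; rewrite nuE//.
  rewrite (_ : \int[mu]_(x in setT) f x = \int[mu]_(x in setT) `|f x|); last first.
    by apply: eq_integral => x _; rewrite gee0_abs.
  apply/ae_eq_integral_abs => //.
  exists (\bigcup_n D n); split => //; first exact: bigcup_measurable.
  move=> x /= /not_implyP[_ /eqP fx].
  have : (0 < fine (f x))%R by rewrite fine_gt0// lt0e fx f0 ltey_eq ffin.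
  move=> /ltr_add_invr[n]; rewrite add0r => nf; exists n => //.
  by rewrite /D/= -(fineK (ffin x)) lee_fin ltW.
have Dn0 : mu (D n) != 0 by rewrite gt_eqF.
have [B [mB BD B0 Boo]] := sigma_finite_subset muF (mD n) Dn0.
exists (n.+1%:R^-1)%R, B; split=> [|A mA AB]; first by split; rewrite ?invr_gt0.
rewrite nuE// -integral_cst//; apply: ge0_le_integral => //.
- by move=> x _ /=; rewrite lee_fin invr_ge0.
- exact: measurable_funTS.
- by move=> x /AB/BD.
Qed.

End density.

(** * Modular integrals, Luxemburg norms and scaled indicators *)

Section orlicz.
Context d (X : measurableType d) (R : realType).
Variables (mu : {measure set X -> \bar R}) (k : scalar_kind) (Phi : R -> R).
Hypothesis young : young_function Phi.
Implicit Types (g : L0 mu k) (A : set X) (c r : R).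
Local Open Scope ereal_scope.

Lemma measurable_modulus_L0 g :
  measurable_fun [set: X] (fun x => modulus (g x)).
Proof.
by apply: (measurableT_comp (@measurable_modulus R k)); exact: measurable_funP.
Qed.

Lemma measurable_young g c :
  measurable_fun [set: X] (fun x => (Phi (c * modulus (g x)))%:E).
Proof.
apply/measurable_EFinP; apply: measurableT_comp.
  by apply: continuous_measurable_fun; exact: young_continuous young.
by apply: measurable_funM => //; exact: measurable_modulus_L0.
Qed.

(** Shrinking the argument by [t] shrinks a finite integral at least as much, by convexity. Hence
    the infimum defining the norm is over a nonempty set and not a default value. *)
Lemma young_integral_le1 g : orlicz_space mu k Phi g ->
  exists c, (0 < c)%R /\ \int[mu]_x (Phi (modulus (g x) / c))%:E <= 1.
Proof.
move=> [c c0 foo].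
have mg := measurable_young g c.
have g0 x : [set: X] x -> 0 <= (Phi (c * modulus (g x)))%:E.
  by rewrite lee_fin young_ge0.
set I := (\int[mu]_x _) in foo.
have I0 : 0 <= I by exact: integral_ge0.
have fI : I \is a fin_num by rewrite ge0_fin_numE.
have fI0 : (0 <= fine I)%R by rewrite fine_ge0.
(* The summand 1 keeps [t] defined and at most 1 even when [I] is small or zero, while [t * I] stays
   at most 1. *)
pose t : R := (1 + fine I)^-1%R.
have t01 : (0 <= t <= 1)%R by rewrite invr_ge0 invf_le1; lra.
have t0 : (0 < t)%R by rewrite invr_gt0; lra.
exists (t * c)^-1%R; split; first by rewrite invr_gt0 mulr_gt0.
apply: (@le_trans _ _ (t%:E * I)).
  rewrite -ge0_integralZl_EFin//; last exact: ltW.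
  apply: ge0_le_integral => //.
  - by move=> x _; rewrite lee_fin young_ge0.
  - under eq_fun do rewrite invrK mulrC.
    exact: measurable_young.
  - by apply: measurable_funeM.
  - move=> x _; rewrite invrK mulrC -EFinM lee_fin -mulrA.
    exact: young_scale.
rewrite -(fineK fI) -EFinM lee_fin ler_pdivrMl; lra.
Qed.

Lemma luxemburg_norm_ge0 g : orlicz_space mu k Phi g ->
  (0 <= luxemburg_norm Phi g)%R.
Proof.
move=> /young_integral_le1[c gc]; apply: lb_le_inf; first by exists c.
by move=> b [/ltW].
Qed.

Lemma luxemburg_norm_le g c : (0 < c)%R ->
  \int[mu]_x (Phi (modulus (g x) / c))%:E <= 1 ->
  (luxemburg_norm Phi g <= c)%R.
Proof.
move=> c0 gc; apply: ge_inf => //.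
by exists 0%R => b [/ltW].
Qed.

(** Some admissible [b] lies below [c], and the integral decreases in the constant. The strict
    inequality avoids proving that the infimum is attained. *)
Lemma luxemburg_norm_lt g c : orlicz_space mu k Phi g ->
  (luxemburg_norm Phi g < c)%R ->
  \int[mu]_x (Phi (modulus (g x) / c))%:E <= 1.
Proof.
move=> /young_integral_le1[c1 gc1] /inf_lt[|b [b0 gb] bc]; first by exists c1.
apply: le_trans gb; apply: ge0_le_integral => //.
- by move=> x _; rewrite lee_fin young_ge0.
- under eq_fun do rewrite mulrC.
  exact: measurable_young.
- under eq_fun do rewrite mulrC.
  exact: measurable_young.
- move=> x _; rewrite lee_fin; apply: young_homo => //.
  + by rewrite divr_ge0 ?modulus_ge0// ltW// (lt_trans b0).
  + by rewrite ler_wpM2l ?modulus_ge0// lef_pV2 ?posrE ?ltW// (lt_trans b0).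
Qed.

(** Chebyshev's inequality for the increasing function [Phi] on nonnegative reals. *)
Lemma young_integral_ge g A c r : measurable A -> (0 < c)%R -> (0 <= r)%R ->
  {ae mu, forall x, A x -> (r <= modulus (g x))%R} ->
  (Phi (r / c))%:E * mu A <= \int[mu]_x (Phi (modulus (g x) / c))%:E.
Proof.
move=> mA c0 r0 rg.
have mg : measurable_fun [set: X] (fun x => (Phi (modulus (g x) / c))%:E).
  by under eq_fun do rewrite mulrC; exact: measurable_young.
rewrite -integral_cst//.
apply: (@le_trans _ _ (\int[mu]_(x in A) (Phi (modulus (g x) / c))%:E)).
  apply: ae_ge0_le_integral => //.
  - by move=> x _; rewrite lee_fin young_ge0.
  - by move=> x _; rewrite lee_fin young_ge0.
  - exact: measurable_funTS.
  - apply: filterS rg => x rg Ax; rewrite lee_fin; apply: young_homo => //.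
      by rewrite divr_ge0// ltW.
    by rewrite ler_wpM2r ?invr_ge0 ?(ltW c0)//; exact: rg.
by apply: ge0_subset_integral => // x _; rewrite lee_fin young_ge0.
Qed.

Lemma L0_scaled_indicator A r : measurable A ->
  exists g : L0 mu k,
    {ae mu, forall x, g x = if x \in A then real_scalar k r else 0%R}.
Proof.
move=> mA.
pose h x : borel_scalar R k := if x \in A then real_scalar k r else 0%R.
have mh : measurable_fun [set: X] h.
  apply: measurable_fun_ifT => //.
  by apply: (measurable_fun_bool true); rewrite setTI preimage_mem_true.
pose hm : {mfun X >-> borel_scalar R k} :=
  HB.pack h (isMeasurableFun.Build _ _ _ _ h mh).
pose g : L0 mu k := \pi_({mfun_ mu, X >-> borel_scalar R k})%qT hm.
exists g.
(* The canonical representative of the class of [h] agrees with [h] only almost everywhere. *)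
have /eqP := reprK g; rewrite {2}/g eqmodE => /asboolP gh.
by apply: filterS gh => x /(_ I).
Qed.

Lemma young_integral_indicator g A r : measurable A -> (0 <= r)%R ->
  {ae mu, forall x, g x = if x \in A then real_scalar k r else 0%R} ->
  \int[mu]_x (Phi (modulus (g x)))%:E = (Phi r)%:E * mu A.
Proof.
move=> mA r0 gA; rewrite -integral_cst// [RHS]integral_mkcond.
apply: ge0_ae_eq_integral => //.
- under eq_fun do rewrite -[modulus _]mul1r.
  exact: measurable_young.
- by apply/measurable_restrict => //; exact: measurable_cst.
- by move=> x _; rewrite lee_fin young_ge0.
- by move=> x _; rewrite patchE; case: ifP => // _; rewrite lee_fin young_ge0.
- apply: filterS gA => x -> _; rewrite patchE; case: ifP => _.
    by rewrite modulus_real_scalar.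
  by rewrite modulus0 young0.
Qed.

End orlicz.

(** * Testing the operator on scaled indicators *)

Theorem proposition2p4 (R : realType) (k : scalar_kind)
    (d : measure_display) (X : measurableType d)
    (mu : {measure set X -> \bar R})
    (mu_sigma_finite : sigma_finite [set: X] mu)
    (mu_complete : measure_is_complete mu)
    (mu_nonatomic : nonatomic mu)
    (Phi1 Phi2 : R -> R)
    (young1 : young_function Phi1) (young2 : young_function Phi2)
    (not_le : ~ young_le Phi2 Phi1) :
  ~ exists (u : L0 mu k) (T : X -> X)
      (M : orlicz_space mu k Phi1 -> orlicz_space mu k Phi2),
      [/\ measurable_fun [set: X] T, nonsingular mu T,
          weighted_composition M u T, bounded_operator M &
          nonzero_operator M].
Proof.
move=> [u [T [M [mT nsT MuT [C MC] [f0 Mf0]]]]]; apply: not_le.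
have mu_u : measurable_fun [set: X] (fun x => modulus (u x)).
  exact: measurable_modulus_L0.
pose U n := [set x | n.+1%:R^-1 <= modulus (u x)].
have mU n : measurable (U n).
  rewrite -[U n]setTI; apply: measurable_fun_le => //; exact: measurable_cst.
have [|n Un] := @measure_bigcup_neq0 _ _ _ mu U mU.
  (* If the sets [U n] had null union, [u] would vanish almost everywhere, and so would [M f0]. *)
  apply/eqP => U0; apply: Mf0.
  have : {ae mu, forall x, u x = 0}.
    exists (\bigcup_n U n); split => //; first exact: bigcup_measurable.
    move=> x /= ux0; have : 0 < modulus (u x).
      by rewrite lt_neqAle modulus_ge0 andbT eq_sym; apply/eqP => /modulus_eq0.
    by move=> /ltr_add_invr[n]; rewrite add0r => /ltW nu; exists n.
  move=> u0; have Mf0E := MuT f0.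
  by apply: filterS2 u0 Mf0E => x -> ->; rewrite mul0r.
pose r : R := n.+1%:R^-1.
have r0 : 0 < r by rewrite invr_gt0.
have Un0 : mu (U n) != 0%E by rewrite gt_eqF.
have [E [mE EU E0 Eoo]] := sigma_finite_subset mu_sigma_finite (mU n) Un0.
have mTA A : measurable A -> measurable (T @^-1` A).
  by move=> mA; rewrite -[X in measurable X]setTI; exact: mT.
have [nu nuE] : exists nu : {measure set X -> \bar R},
    forall A, nu A = mu (T @^-1` A `&` E).
  by unshelve eexists (pushforward (mrestr mu mE) T).
have nu_fin : fin_num_fun nu.
  move=> A mA; rewrite nuE ge0_fin_numE//; apply: le_lt_trans Eoo.
  apply: le_measure; rewrite ?inE//.
  by apply: measurableI => //; exact: mTA.
have nu_mu : nu `<< mu.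
  apply/null_content_dominatesP => A mA A0; rewrite nuE.
  apply/eqP; rewrite -measure_le0 -(nsT _ mA A0).
  apply: le_measure; rewrite ?inE//; last exact: mTA.
  by apply: measurableI => //; exact: mTA.
have nuT : nu [set: X] != 0%E by rewrite nuE preimage_setT setTI gt_eqF.
have [e [B [[e0 mB B0 Boo] nuB]]] :=
  dominates_lower_bound mu_sigma_finite nu_fin nu_mu nuT.
have fB : mu B \is a fin_num by rewrite ge0_fin_numE// ltW.
have fB0 : 0 < fine (mu B) by rewrite -lte_fin fineK.
(* The bound [C] may be zero or negative; [D] is a positive bound. *)
pose D := Num.max C 1.
have D1 : 1 <= D by rewrite le_max lexx orbT.
have D0 : 0 < D by lra.
(* The threshold on [y] says that [B] has measure at least [(Phi1 y)^-1], so that it contains the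
   required set [A]. *)
have key y : 0 < y -> (fine (mu B))^-1 <= Phi1 y ->
    Phi2 (r * y / (2 * D)) <= 2 / e * Phi1 y.
  move=> y0 yB; have P0 := young_gt0 young1 y0.
  have PB : ((Phi1 y)^-1%:E <= mu B)%E.
    by rewrite -(fineK fB) lee_fin -[leRHS]invrK lef_pV2 ?posrE ?invr_gt0.
  have PV0 : 0 < (Phi1 y)^-1 by rewrite invr_gt0.
  have [A [mA AB A1 A2]] := nonatomic_intermediate mu_nonatomic mB Boo PV0 PB.
  have [f fA] := L0_scaled_indicator mu k y mA.
  have intf := young_integral_indicator young1 mA (ltW y0) fA.
  have intf1 : (\int[mu]_x (Phi1 (modulus (f x)))%:E <= 1)%E.
    apply: (@le_trans _ _ ((Phi1 y)%:E * ((Phi1 y)^-1)%:E)%E).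
      by rewrite intf lee_wpmul2l// lee_fin ltW.
    by rewrite -EFinM mulfV// gt_eqF.
  have fO : orlicz_space mu k Phi1 f.
    exists 1 => //; under eq_integral do rewrite mul1r.
    by rewrite (le_lt_trans intf1)// ltry.
  have f1 : luxemburg_norm Phi1 f <= 1.
    apply: luxemburg_norm_le => //.
    by under eq_integral do rewrite divr1.
  have f0' := luxemburg_norm_ge0 young1 fO.
  pose F : orlicz_space mu k Phi1 := exist _ f (mem_set fO).
  (* The norm is at most [D]; the factor 2 provides the strict inequality required by
     [luxemburg_norm_lt]. *)
  have MF : luxemburg_norm Phi2 (val (M F)) < 2 * D.
    apply: (@le_lt_trans _ _ D); last by lra.
    apply: le_trans (MC F) _; apply: (@le_trans _ _ (D * luxemburg_norm Phi1 f)).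
      by rewrite ler_wpM2r// le_max lexx.
    by rewrite ler_piMr// ltW.
  have MFO : orlicz_space mu k Phi2 (val (M F)) by exact: set_mem (valP (M F)).
  have intMF := luxemburg_norm_lt young2 MFO MF.
  have mTAE : measurable (T @^-1` A `&` E) by apply: measurableI => //; exact: mTA.
  (* [f] equals the scaled indicator off a null set [N]; nonsingularity makes the preimage of [N]
     null, so the equality survives composition with [T]. *)
  have fT : {ae mu, forall x, A (T x) -> f (T x) = real_scalar k y}.
    case: fA => N [mN N0 fN]; exists (T @^-1` N); split; [exact: mTA|exact: nsT|].
    move=> x /= fTx; apply: fN => /= fTxE; apply: fTx => ATx.
    by rewrite fTxE mem_set.
  have ryM : {ae mu, forall x, (T @^-1` A `&` E) x ->
      r * y <= modulus (val (M F) x)}.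
    have MFE := MuT F; apply: filterS2 fT MFE => x fTx -> [ATx Ex].
    rewrite /F/= fTx// modulusM modulus_real_scalar ?(ltW y0)//.
    by rewrite ler_wpM2r ?(ltW y0)//; exact: EU.
  have D20 : 0 < 2 * D by lra.
  have ry0 : 0 <= r * y by rewrite mulr_ge0 ?ltW.
  have := le_trans (young_integral_ge young2 mTAE D20 ry0 ryM) intMF.
  rewrite -nuE => le1.
  (* Here [nu A] is bounded below by [e * mu A], and [mu A] by [(Phi1 y)^-1 / 2]. *)
  have : ((Phi2 (r * y / (2 * D)))%:E * (e%:E * ((Phi1 y)^-1 / 2)%:E) <= 1)%E.
    apply: le_trans le1; apply: lee_wpmul2l; first by rewrite lee_fin young_ge0.
    apply: le_trans (nuB _ mA AB); apply: lee_wpmul2l => //.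
    by rewrite lee_fin ltW.
  rewrite -!EFinM lee_fin => le1'.
  have -> : 2 / e * Phi1 y = (e * ((Phi1 y)^-1 / 2))^-1.
    by field; rewrite !gt_eqF.
  by rewrite -[leRHS]mul1r ler_pdivlMr// !mulr_gt0 ?invr_gt0.
(* The maximum with 1 makes [young_scale_ge1] applicable. *)
pose K := Num.max 1 (2 / e).
have K1 : 1 <= K by rewrite le_max lexx.
have [y0 [y0r y0P]] := (cvgryPge _).1 (young_cvg_pinfty young1) (fine (mu B))^-1.
(* Chosen so that [y = z * s] turns the argument [r * y / (2 * D)] of [Phi2] into [z]. *)
pose s := 2 * D / r.
have s0 : 0 < s by rewrite divr_gt0//; lra.
(* For [z] beyond the second witness, [z * s] is at least [|y0| + 1], hence both positive and
   strictly above [y0]. *)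
exists (K * s), ((`|y0| + 1) / s); split.
- by rewrite mulr_ge0 ?(ltW s0)//; lra.
- by rewrite divr_ge0 ?(ltW s0)// addr_ge0.
move=> z; rewrite ler_pdivrMr// => zs.
have y0z : y0 < z * s.
  by apply: lt_le_trans zs; rewrite (le_lt_trans (ler_norm _))// ltrDl.
have zs0 : 0 < z * s by apply: lt_le_trans zs; rewrite ltr_wpDl.
have := key (z * s) zs0 (y0P _ y0z).
have -> : r * (z * s) / (2 * D) = z by rewrite /s; field; rewrite !gt_eqF.
move=> /le_trans; apply.
rewrite -(mulrA K) (mulrC s); apply: le_trans (young_scale_ge1 young1 _ K1).
by rewrite ler_wpM2r ?young_ge0// le_max lexx orbT.
Qed.
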